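(* Let $P,Q$ be probability measures on a measurable space with densities $p,q$ with respect to a dominating measure $\lambda$, let $q_0\in(0,1)$ be a parameter, and let $\rho_{q_0}=\rho_{q_0}(P\|Q)=\int p^{q_0}q^{1-q_0}\,d\lambda$ be the Chernoff $\alpha$-coefficient with parameter $q_0$. The envelope of the family of straight lines $$(2-s)\alpha+s\beta=s^{q_0}(2-s)^{1-q_0}\rho_{q_0},\qquad s\in(0,2),$$ is the curve $$\beta=\left(q_0^{q_0}(1-q_0)^{1-q_0}\rho_{q_0}\right)^{\frac1{q_0}}\alpha^{\frac{q_0-1}{q_0}},$$ which is an upper bound of the Neyman-Pearson boundary of $(P,Q)$: the boundary satisfies $$\beta\le\left(q_0^{q_0}(1-q_0)^{1-q_0}\rho_{q_0}\right)^{\frac1{q_0}}\alpha^{\frac{q_0-1}{q_0}}.$$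
   Context: Tests: the hypotheses are $H_0$: $x$ is a sample from $Q$, and $H_1$: $x$ is a sample from $P$. A (possibly randomized) test is a measurable $\phi:\Omega\to[0,1]$, accepting $H_0$ with probability $\phi(x)$ and $H_1$ with probability $1-\phi(x)$; its false positive rate is $\alpha=\int(1-\phi)\,dQ$ and its false negative rate is $\beta=\int\phi\,dP$. The Neyman-Pearson region is the set of all $(\alpha,\beta)$ attained by tests, and the Neyman-Pearson boundary is its lower boundary, given by the minimum $\beta$ for each $\alpha\in[0,1]$. Envelope: for a family of lines $F(\alpha,\beta,s)=0$, $s\in(0,2)$, the envelope is determined by the two equations $F(\alpha,\beta,s)=0$ and $\partial F/\partial s(\alpha,\beta,s)=0$.
   Formalization: The envelope is identified with the curve only when the Chernoff coefficient is positive; if it is 0 (P, Q mutually singular) the envelope equations give only the point (0,0), so the claim fails there. The upper bound is stated in all cases. *)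

(* Defs.v *)
From HB Require Import structures.
From mathcomp Require Import all_boot all_order all_algebra.
From mathcomp Require Import all_classical all_reals all_analysis.

Set Implicit Arguments.
Unset Strict Implicit.
Unset Printing Implicit Defensive.

Import Order.TTheory GRing.Theory Num.Theory.
Import numFieldNormedType.Exports.

Local Open Scope classical_set_scope.
Local Open Scope ring_scope.

Definition is_density d (T : measurableType d) (R : realType)
    (lam : {measure set T -> \bar R}) (P : probability T R) (p : T -> R) :=
  [/\ measurable_fun [set: T] p,
      forall x, 0 <= p x &
      forall A, measurable A -> P A = (\int[lam]_(x in A) (p x)%:E)%E].

(* [Rintegral] is 0 when the integral is infinite.  That does not happen for
   densities, since p^q0 q^(1 - q0) <= q0 p + (1 - q0) q. *)
Definition chernoff_coef d (T : measurableType d) (R : realType)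
    (lam : {measure set T -> \bar R}) (p q : T -> R) (q0 : R) : R :=
  \int[lam]_x (p x `^ q0 * q x `^ (1 - q0)).

Section NeymanPearson.
Context d (T : measurableType d) (R : realType).
Implicit Types (P Q : probability T R) (phi : T -> R).

(* phi x is the probability of accepting H0 (x was drawn from Q) *)
Definition is_test phi :=
  measurable_fun [set: T] phi /\ (forall x, 0 <= phi x <= 1).

Definition false_positive Q phi : R := \int[Q]_x (1 - phi x).

Definition false_negative P phi : R := \int[P]_x phi x.

Definition np_region P Q : set (R * R) :=
  [set (false_positive Q phi, false_negative P phi) | phi in is_test].

(* (alpha, beta) such that beta is the minimum of the region above alpha *)
Definition np_boundary P Q : set (R * R) :=
  [set ab | np_region P Q ab /\
            forall b, np_region P Q (ab.1, b) -> ab.2 <= b].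

End NeymanPearson.

Definition envelope (R : realType) (S : set R) (F : R -> R -> R -> R) :
    set (R * R) :=
  [set ab | exists2 s, S s &
     F ab.1 ab.2 s = 0 /\ is_derive s (1 : R) (F ab.1 ab.2) 0].

Definition chernoff_line (R : realType) (q0 rho alpha beta s : R) : R :=
  (2 - s) * alpha + s * beta - s `^ q0 * (2 - s) `^ (1 - q0) * rho.

(* Real power x^r for x >= 0, with 0^r = +oo for r < 0, whereas the library's
   0 `^ r is 0 there. *)
Definition epowR (R : realType) (x r : R) : \bar R :=
  if (x == 0) && (r < 0) then +oo%E else (x `^ r)%:E.

(* At alpha = 0 the value is +oo if rho > 0; if rho = 0 it is 0 * +oo, which is
   0 in \bar R. *)
Definition chernoff_curve (R : realType) (q0 rho alpha : R) : \bar R :=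
  (((q0 `^ q0 * (1 - q0) `^ (1 - q0) * rho) `^ q0^-1)%:E
   * epowR alpha ((q0 - 1) / q0))%E.

(* Main.v *)
Require Import Defs.
From HB Require Import structures.
From mathcomp Require Import all_boot all_order all_algebra.
From mathcomp Require Import all_classical all_reals all_analysis.
From mathcomp Require Import measurable_realfun ring.

Set Implicit Arguments.
Unset Strict Implicit.
Unset Printing Implicit Defensive.

Import Order.TTheory GRing.Theory Num.Theory.
Import numFieldNormedType.Exports.

Local Open Scope classical_set_scope.
Local Open Scope ring_scope.

(** The envelope and the upper bound are linked by the substitution
    [t = s / (2 - s)], which turns [(0, 2)] into the half-line [t > 0].

    Envelope. The equations [F = 0] and [dF/ds = 0] are linear in
    [(alpha, beta)], and solving them gives
      [alpha = (1 - q0) rho t^q0], [beta = q0 rho t^(q0 - 1)]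
    ([envelope_chernoff_lineP]). Eliminating [t] gives the curve
    ([chernoff_curve_param]).

    Upper bound. For a weight [k >= 0] and a test [phi],
      [k alpha + beta = \int (k (1 - phi) q + phi p) dlam],
    whose integrand is at least [min (k q, p)], with equality when [phi] is a
    likelihood ratio test: accept [Q] where [p < k q], reject it where
    [p > k q], randomize on ties. Hence likelihood ratio tests minimize [beta]
    at their own [alpha] (Neyman-Pearson), and as
    [min (k q, p) <= k^(1 - q0) p^q0 q^(1 - q0)] they satisfy
      [k alpha + beta <= k^(1 - q0) rho].
    For [k = 0] this gives [beta <= 0]; for [k = 1 / t] it says that
    [(alpha, beta)] lies on or below one of the lines of the family. Each of these lines is tangent to the curve, which is convex
    in [alpha], so it lies below the curve; concretely this is the weighted
    inequality between arithmetic and geometric means ([chernoff_tangent_le]).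

    It remains to reach every level [alpha]. For [0 < alpha <= 1] take for [k] a
    quantile of order [1 - alpha] of [p / q] under [Q]; a jump of the
    distribution function there is absorbed by the randomization
    ([randomized_quantile], [likelihood_ratio_test_level]). At [alpha = 0] no
    finite threshold may do, and the optimal test accepts [Q] exactly where
    [q > 0] ([support_test_optimal]). The curve is [+oo] there unless
    [rho = 0], in which case [P] and [Q] are mutually singular and the support
    test makes no error at all. *)

(** * Real powers, the curve and the envelope *)

Section RealPowers.
Context (R : realType).
Implicit Types a b k rho s t alpha : R.

(** Weighted arithmetic-geometric mean inequality, i.e. Young's inequality for
    the conjugate exponents [t^-1] and [(1 - t)^-1]. *)
Lemma powR_amgm a b t : 0 <= a -> 0 <= b -> 0 < t < 1 ->
  a `^ t * b `^ (1 - t) <= t * a + (1 - t) * b.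
Proof.
move=> a0 b0 /andP[t0 t1].
have t1' : 0 < 1 - t by rewrite subr_gt0.
have := @conjugate_powR R (a `^ t) (b `^ (1 - t)) t^-1 (1 - t)^-1.
rewrite !powR_ge0 !invr_gt0 !invrK -!powRrM !divff ?gt_eqF// !powRr1//.
move=> /(_ isT isT t0 t1'); rewrite (mulrC a) (mulrC b); apply.
by rewrite addrC subrK.
Qed.

Lemma minr_le_powR_mean a b t : 0 <= a -> 0 <= b -> 0 < t < 1 ->
  Num.min a b <= a `^ t * b `^ (1 - t).
Proof.
move=> a0 b0 /andP[t0 t1].
have m0 : 0 <= Num.min a b by rewrite le_min a0.
have mE : Num.min a b = Num.min a b `^ t * Num.min a b `^ (1 - t).
  by rewrite -powRD addrCA subrr addr0 ?powRr1// oner_eq0.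
rewrite {1}mE ler_pM ?powR_ge0//.
- by apply: ge0_ler_powR (ltW t0) _ _ m0 a0 _; rewrite ge_min lexx.
- apply: ge0_ler_powR _ _ _ m0 b0 _; first by rewrite subr_ge0 ltW.
  by rewrite ge_min lexx orbT.
Qed.

Lemma chernoff_curve_ge0 q0 rho alpha : (0 <= chernoff_curve q0 rho alpha)%E.
Proof.
apply: mule_ge0; first by rewrite lee_fin powR_ge0.
by rewrite /epowR; case: ifP => // _; rewrite lee_fin powR_ge0.
Qed.

Lemma chernoff_curveE q0 rho alpha : 0 < alpha ->
  chernoff_curve q0 rho alpha =
  ((q0 `^ q0 * (1 - q0) `^ (1 - q0) * rho) `^ q0^-1
    * alpha `^ ((q0 - 1) / q0))%:E.
Proof. by move=> a0; rewrite /chernoff_curve /epowR gt_eqF. Qed.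

(** With [c] the value of the curve at [alpha], the weighted inequality of means
    applied to [c / q0] and [k alpha / (1 - q0)] reads
    [k^(1 - q0) rho <= c + k alpha]: the powers of [q0], [1 - q0] and [alpha] on
    the left cancel those in [c]. *)
Lemma chernoff_tangent_le q0 rho alpha k : 0 < q0 < 1 -> 0 <= rho ->
  0 < alpha -> 0 <= k ->
  ((k `^ (1 - q0) * rho - k * alpha)%:E <= chernoff_curve q0 rho alpha)%E.
Proof.
move=> hq rho0 a0 k0; case/andP: (hq) => q00 q01.
have q1 : 0 < 1 - q0 by rewrite subr_gt0.
rewrite chernoff_curveE// lee_fin lerBlDr.
set c := _ * alpha `^ _.
have c0 : 0 <= c by rewrite mulr_ge0// powR_ge0.
have <- : q0 * (c / q0) + (1 - q0) * (k * alpha / (1 - q0)) = c + k * alpha.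
  by field; rewrite !gt_eqF.
have cq0 : 0 <= c / q0 by rewrite divr_ge0// ltW.
have ka0 : 0 <= k * alpha / (1 - q0).
  by rewrite divr_ge0 ?(ltW q1)// mulr_ge0// ltW.
apply: le_trans (powR_amgm cq0 ka0 hq).
have cE : c `^ q0 = q0 `^ q0 * (1 - q0) `^ (1 - q0) * rho * alpha `^ (q0 - 1).
  rewrite /c powRM ?powR_ge0// -!powRrM mulVf ?gt_eqF// divfK ?gt_eqF//.
  by rewrite powRr1// !mulr_ge0// powR_ge0.
clearbody c.
rewrite !powRM ?invr_ge0 ?mulr_ge0 ?(ltW q00) ?(ltW q1) ?(ltW a0)//.
have aE : alpha `^ (q0 - 1) * alpha `^ (1 - q0) = 1.
  rewrite -powRD; last by rewrite (gt_eqF a0) implybT.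
  by rewrite (_ : q0 - 1 + (1 - q0) = 0) ?powRr0//; ring.
rewrite -!powR_inv1 ?(ltW q00) ?(ltW q1)// -!powRrM.
rewrite !mulN1r !powRN cE.
set u := q0 `^ q0; set v := (1 - q0) `^ _.
have u0 : u != 0 by rewrite gt_eqF// powR_gt0.
have v0 : v != 0 by rewrite gt_eqF// powR_gt0.
rewrite [leRHS](_ : _ =
  k `^ (1 - q0) * rho * (alpha `^ (q0 - 1) * alpha `^ (1 - q0))).
  by rewrite aE mulr1.
by field; rewrite ?u0 ?v0.
Qed.

Lemma is_derive_chernoff_line q0 rho a b s : 0 < s < 2 ->
  is_derive s 1 (chernoff_line q0 rho a b)
    (b - a - rho * (s `^ q0 * (2 - s) `^ (1 - q0))
               * (q0 / s - (1 - q0) / (2 - s))).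
Proof.
move=> /andP[s0 s2].
have s2' : 0 < 2 - s by rewrite subr_gt0.
have d1 : is_derive s (1 : R) ((cst 2 : R -> R) - (id : R -> R)) (-1).
  by rewrite -[-1]sub0r; apply: is_deriveB.
have d2 : is_derive s 1 (fun x : R => (2 - x) `^ (1 - q0))
    (- ((1 - q0) * (2 - s) `^ (1 - q0 - 1))).
  rewrite -mulrN1.
  exact: (@is_derive1_comp _ (@powR R ^~ (1 - q0)) _ s _ _
    (is_derive1_powR (1 - q0) s2') d1).
have d3 := is_derive1_powR q0 s0.
set f2 := (fun x : R => (2 - x) `^ _) in d2.
set f3 := (fun x : R => x `^ q0) in d3.
rewrite [X in is_derive _ _ X _](_ : _ =
  ((cst 2 : R -> R) - (id : R -> R)) * cst a + id * cst b - f3 * f2 * cst rho)//.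
apply: is_derive_eq.
rewrite /f2 /f3 /= /GRing.scale /= !fctE /=.
rewrite !powRB ?powRr1 ?(ltW s0) ?(ltW s2') ?(gt_eqF s0) ?(gt_eqF s2') ?implybT//.
by field; rewrite !gt_eqF ?powR_gt0.
Qed.

(** Writing [F] for the line and [D] for its derivative in [s], the combinations
    [F - s D] and [F + (2 - s) D] isolate [2 alpha] and [2 beta]. *)
Lemma envelope_chernoff_lineP q0 rho a b :
  envelope `]0, 2[ (chernoff_line q0 rho) (a, b) <->
  exists2 t, 0 < t &
    a = (1 - q0) * rho * t `^ q0 /\ b = q0 * rho * t `^ (q0 - 1).
Proof.
have powsE s : 0 < s -> 0 < 2 - s ->
    s `^ q0 * (2 - s) `^ (1 - q0) = (2 - s) * (s / (2 - s)) `^ q0.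
  move=> s0 s2; rewrite powRM ?invr_ge0 ?ltW// -powR_inv1 ?ltW// -powRrM mulN1r.
  rewrite powRN powRB ?(gt_eqF s2) ?implybT// powRr1 ?ltW//.
  by field; rewrite gt_eqF// powR_gt0.
have powB1 t : 0 < t -> t `^ (q0 - 1) = t `^ q0 / t.
  by move=> t0; rewrite powRB ?(gt_eqF t0) ?implybT// powRr1 ?ltW.
split.
  case=> s /=; rewrite in_itv /= => hs [F0 dF].
  have /andP[s0 s2] := hs; have s2' : 0 < 2 - s by rewrite subr_gt0.
  have /@derive_val := is_derive_chernoff_line q0 rho a b hs.
  rewrite derive_val => /esym D0; move: F0 D0.
  rewrite /chernoff_line /= powsE// => F0 D0.
  exists (s / (2 - s)); first by rewrite divr_gt0.
  rewrite powB1 ?divr_gt0//; set T := _ `^ q0 in F0 D0 *.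
  set F := (X in X = 0) in F0; set D := (X in X = 0) in D0.
  have two0 : (2 : R) != 0 by rewrite pnatr_eq0.
  split; apply: (mulIf two0); apply/eqP; rewrite -subr_eq0.
    have -> : a * 2 - (1 - q0) * rho * T * 2 = F - s * D.
      by rewrite /F /D; field; rewrite !gt_eqF.
    by rewrite F0 D0 mulr0 subr0.
  have -> : b * 2 - q0 * rho * (T / (s / (2 - s))) * 2 = F + (2 - s) * D.
    by rewrite /F /D; field; rewrite !gt_eqF.
  by rewrite F0 D0 mulr0 addr0.
case=> t t0 [aE bE].
have t1 : 0 < 1 + t by rewrite addr_gt0.
(* the inverse of the change of parameter t = s / (2 - s) *)
pose s := 2 * t / (1 + t).
have s0 : 0 < s by rewrite divr_gt0// mulr_gt0.
have sE : 2 - s = 2 / (1 + t) by rewrite /s; field; rewrite gt_eqF.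
have s2' : 0 < 2 - s by rewrite sE divr_gt0.
have hs : 0 < s < 2 by rewrite s0 -subr_gt0.
have tE : s / (2 - s) = t by rewrite sE /s; field; rewrite gt_eqF.
exists s; first by rewrite /= in_itv.
split=> /=.
  rewrite /chernoff_line powsE// tE aE bE powB1// sE /s.
  by field; rewrite !gt_eqF.
have := is_derive_chernoff_line q0 rho a b hs.
set D := (X in is_derive _ _ _ X) => dF.
suff <- : D = 0 by [].
rewrite /D powsE// tE aE bE powB1// sE /s.
by field; rewrite !gt_eqF.
Qed.

Lemma chernoff_curve_param q0 rho t : 0 < q0 < 1 -> 0 < rho -> 0 < t ->
  chernoff_curve q0 rho ((1 - q0) * rho * t `^ q0) =
  (q0 * rho * t `^ (q0 - 1))%:E.
Proof.
move=> /andP[q00 q01] rho0 t0.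
have q1 : 0 < 1 - q0 by rewrite subr_gt0.
rewrite chernoff_curveE ?mulr_gt0 ?powR_gt0//; congr (_%:E).
apply: ln_inj; rewrite ?posrE ?mulr_gt0 ?powR_gt0 ?mulr_gt0 ?powR_gt0//.
rewrite !(lnM, ln_powR) ?posrE ?mulr_gt0 ?powR_gt0 ?mulr_gt0 ?powR_gt0//.
by field; rewrite gt_eqF.
Qed.

Lemma envelope_chernoff_line q0 rho : 0 < q0 < 1 -> 0 < rho ->
  envelope `]0, 2[ (chernoff_line q0 rho) =
  [set ab | 0 < ab.1 /\ ab.2%:E = chernoff_curve q0 rho ab.1].
Proof.
move=> hq rho0; have /andP[q00 q01] := hq.
have q1 : 0 < 1 - q0 by rewrite subr_gt0.
apply/seteqP; split => -[a b].
  move=> /envelope_chernoff_lineP[t t0 [-> ->]] /=.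
  by rewrite !mulr_gt0 ?powR_gt0//; split=> //; rewrite chernoff_curve_param.
move=> /= [a0 bE]; apply/envelope_chernoff_lineP.
pose t := (a / ((1 - q0) * rho)) `^ q0^-1.
have t0 : 0 < t by rewrite powR_gt0// divr_gt0// mulr_gt0.
have aE : a = (1 - q0) * rho * t `^ q0.
  rewrite /t -powRrM mulVf ?gt_eqF// powRr1 ?divr_ge0 ?mulr_ge0 ?ltW//.
  by field; rewrite !gt_eqF.
exists t => //; split=> //; apply: EFin_inj.
by rewrite bE [in LHS]aE chernoff_curve_param.
Qed.

End RealPowers.

(** * Integration against a density *)

Section ChangeOfMeasure.
Context d (T : measurableType d) (R : realType).
Variables (lam nu : {measure set T -> \bar R}) (g : T -> R).
Hypotheses (mg : measurable_fun [set: T] g) (g0 : forall x, 0 <= g x).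
Hypothesis nuE : forall A, measurable A ->
  nu A = (\int[lam]_(x in A) (g x)%:E)%E.
Local Open Scope ereal_scope.

Let integral_density_indic (E : set T) : measurable E ->
  \int[nu]_x (\1_E x)%:E = \int[lam]_x ((\1_E x)%:E * (g x)%:E).
Proof.
move=> mE; rewrite integral_indic// setIT nuE// integral_mkcond.
apply: eq_integral => x _; rewrite patchE indicE.
by case: ifPn; rewrite ?mul1e ?mul0e.
Qed.

Import HBNNSimple.

Let integral_density_nnsfun (f : {nnsfun T >-> R}) :
  \int[nu]_x (f x)%:E = \int[lam]_x ((f x)%:E * (g x)%:E).
Proof.
have mgE : measurable_fun [set: T] (EFin \o g : T -> \bar R)
  by exact/measurable_EFinP.
under [LHS]eq_integral do rewrite fimfunE -fsumEFin//.
rewrite [LHS]ge0_integral_fsum//; last 2 first.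
  - by move=> r; exact/measurable_EFinP/measurableT_comp.
  - by move=> n x _; rewrite EFinM nnfun_muleindic_ge0.
under [RHS]eq_integral.
  move=> x xD; rewrite fimfunE -fsumEFin// muleC ge0_mule_fsumr; last first.
    by move=> r; rewrite EFinM nnfun_muleindic_ge0.
  over.
rewrite [RHS]ge0_integral_fsum//; last 2 first.
  - move=> r; apply: emeasurable_funM => //.
    exact/measurable_EFinP/measurableT_comp.
  - move=> n x _; rewrite EFinM mule_ge0//; last by rewrite nnfun_muleindic_ge0.
    by rewrite lee_fin.
apply: eq_fsbigr => r /set_mem[x _ <-].
rewrite integralZl_indic_nnsfun// integral_density_indic//.
rewrite -ge0_integralZl//.
- by apply: eq_integral => t _; rewrite EFinM muleA muleC.
- apply: emeasurable_funM => //; exact/measurable_EFinP/measurable_indic.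
- by move=> t _; rewrite mule_ge0// lee_fin.
- by rewrite lee_fin.
Qed.

(** The hypothesis is the case of indicators; linearity gives nonnegative simple
    functions and monotone convergence the rest. *)
Lemma integral_density (f : T -> \bar R) :
  measurable_fun [set: T] f -> (forall x, 0 <= f x) ->
  \int[nu]_x f x = \int[lam]_x (f x * (g x)%:E).
Proof.
move=> mf f0.
have mgE : measurable_fun [set: T] (EFin \o g : T -> \bar R)
  by exact/measurable_EFinP.
pose f_ := nnsfun_approx measurableT mf.
have cvg_f x : (f_ n x)%:E @[n --> \oo] --> f x.
  by apply: cvg_nnsfun_approx.
transitivity (lim (\int[nu]_x (f_ n x)%:E @[n --> \oo])).
  rewrite -monotone_convergence//=.
  - by apply: eq_integral => x _; apply/esym/cvg_lim => //.
  - by move=> n; exact/measurable_EFinP/measurable_funTS.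
  - by move=> n ? _; rewrite lee_fin.
  - by move=> ? _ ? ? mn; rewrite lee_fin; exact/lefP/nd_nnsfun_approx.
under eq_fun do rewrite integral_density_nnsfun.
rewrite -monotone_convergence//=.
- apply: eq_integral => x _; apply/cvg_lim => //.
  by apply: cvgeZr => //; exact: cvg_f.
- move=> n; apply: emeasurable_funM => //.
  exact/measurable_EFinP/measurable_funTS.
- by move=> n ? _; rewrite mule_ge0// lee_fin.
- move=> x _ m n mn; rewrite lee_pmul// ?lee_fin//.
  exact/lefP/nd_nnsfun_approx.
Qed.

End ChangeOfMeasure.

Section Densities.
Context d (T : measurableType d) (R : realType).
Variables (lam : {measure set T -> \bar R}).

Lemma density_integrable (P : probability T R) (p : T -> R) :
  is_density lam P p -> lam.-integrable [set: T] (EFin \o p).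
Proof.
move=> [mp p0 pE]; apply/integrableP; split; first exact/measurable_EFinP.
under eq_integral => x _ do rewrite /= ger0_norm//.
by rewrite -pE// probability_setT ltry.
Qed.

Lemma integrable_weighted (P : probability T R) (p w : T -> R) :
  is_density lam P p -> measurable_fun [set: T] w ->
  (forall x, 0 <= w x <= 1) ->
  lam.-integrable [set: T] (EFin \o (fun x => w x * p x)).
Proof.
move=> hp mw w01; have [mp p0 _] := hp.
apply: le_integrable (density_integrable hp) => //.
  exact/measurable_EFinP/measurable_funM.
move=> x _ /=; have /andP[w0 w1] := w01 x.
by rewrite lee_fin !ger0_norm ?mulr_ge0// ler_piMl.
Qed.

Lemma Rintegral_density (P : probability T R) (p w : T -> R) :
  is_density lam P p -> measurable_fun [set: T] w ->
  (forall x, 0 <= w x) ->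
  \int[P]_x w x = \int[lam]_x (w x * p x).
Proof.
move=> [mp p0 pE] mw w0; congr fine.
by rewrite (integral_density mp p0 pE)//; exact/measurable_EFinP.
Qed.

(** A nonnegative function with zero integral vanishes almost everywhere, so a
    comparison on its zero set suffices. *)
Lemma le_Rintegral_on_zeros (f g h : T -> R) :
  lam.-integrable [set: T] (EFin \o f) ->
  lam.-integrable [set: T] (EFin \o g) ->
  lam.-integrable [set: T] (EFin \o h) ->
  (forall x, 0 <= f x) -> (forall x, 0 <= g x) -> (forall x, 0 <= h x) ->
  (forall x, f x = 0 -> g x <= h x) ->
  \int[lam]_x f x = 0 -> \int[lam]_x g x <= \int[lam]_x h x.
Proof.
move=> fi gi hi f0 g0 h0 fgh int_f.
have mf := measurable_int _ fi.
have : (\int[lam]_x `|(EFin \o f) x| = 0)%E.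
  under eq_integral => x _ do rewrite /= ger0_norm//.
  rewrite -[LHS]fineK; last exact: integrable_fin_num.
  by rewrite [fine _]int_f.
move=> /(ae_eq_integral_abs lam measurableT mf) fae.
apply: fine_le; [exact: integrable_fin_num|exact: integrable_fin_num|].
apply: ae_ge0_le_integral => //.
- by move=> x _; rewrite lee_fin.
- exact: measurable_int gi.
- by move=> x _; rewrite lee_fin.
- exact: measurable_int hi.
apply: filterS fae => x /(_ I) [fx] _.
by rewrite lee_fin fgh.
Qed.

Lemma Rintegral_probability_cst (Q : probability T R) (c : R) :
  \int[Q]_(x in [set: T]) c = c.
Proof.
rewrite Rintegral_cst// -[RHS]mulr1; congr (_ * _).
exact: (congr1 fine (probability_setT Q)).
Qed.

End Densities.

(** * Threshold tests and quantiles *)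

Section ThresholdTests.
Context d (T : measurableType d) (R : realType).
Implicit Types (f g phi : T -> R) (c : R).

Definition threshold_test f g c (x : T) : R :=
  if f x < g x then 1 else if f x == g x then c else 0.

Lemma is_test_threshold f g c :
  measurable_fun [set: T] f -> measurable_fun [set: T] g -> 0 <= c <= 1 ->
  is_test (threshold_test f g c).
Proof.
move=> mf mg /andP[c0 c1]; split; last first.
  move=> x; rewrite /threshold_test; case: ifP => _; first by rewrite ler01 lexx.
  by case: ifP => _; rewrite ?c0 ?c1 ?lexx ?ler01.
apply: measurable_fun_ifT => //; first exact: measurable_fun_ltr.
by apply: measurable_fun_ifT => //; exact: measurable_fun_eqr.
Qed.

Lemma is_test_compl phi : is_test phi -> is_test (fun x => 1 - phi x).
Proof.
move=> [mphi h]; split; first exact: measurable_funB.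
by move=> x; have /andP[a b] := h x; rewrite subr_ge0 b lerBlDr lerDl.
Qed.

Lemma is_test_integrable (Q : probability T R) phi :
  is_test phi -> Q.-integrable [set: T] (EFin \o phi).
Proof.
move=> [mphi h]; apply: le_integrable
  (finite_measure_integrable_cst Q 1 measurableT) => //.
  exact/measurable_EFinP.
move=> x _ /=; have /andP[a b] := h x.
by rewrite lee_fin normr1 ger0_norm.
Qed.

End ThresholdTests.

Section RandomizedQuantile.
Context d (T : measurableType d) (R : realType) (Q : probability T R).

(** The infimum [k] of the [k' >= 0] with [a <= cdf X k'] works: the upper bound
    is right continuity of the distribution function at [k], and the lower bound
    is its limit from the left along [k - 1 / (n + 1)], where [a] is not
    exceeded: these points are outside the set, or negative, where the
    distribution function vanishes. *)
Lemma quantile_exists (X : {RV Q >-> R}) (a : R) :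
  (forall x, 0 <= X x) -> 0 <= a < 1 ->
  exists2 k, 0 <= k &
    (Q [set x | (X x < k)%R] <= a%:E <= Q [set x | (X x <= k)%R])%E.
Proof.
move=> X0 /andP[a0 a1].
pose S := [set k | 0 <= k /\ (a%:E <= cdf X k)%E].
have S0 : S !=set0.
  have [//|/nonemptyPn noS] := pselect (S !=set0).
  suff : (1 <= a%:E)%E by rewrite lee_fin leNgt a1.
  apply: cvge_le (cvg_cdfy1 X); near=> k.
  rewrite leNgt; apply/negP => /ltW ak.
  suff : S k by rewrite noS.
  by split=> //; near: k; exact: nbhs_pinfty_ge.
have Slb : has_lbound S by exists 0 => k [].
have k0 : 0 <= inf S by apply: lb_le_inf => // k [].
exists (inf S) => //; apply/andP; split; last first.
  have : (a%:E <= cdf X (inf S))%E.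
    apply: cvge_ge (@cdf_right_continuous _ _ _ _ X (inf S)).
    near=> r.
    have /(inf_lt S0)[s [s0 as_] sr] : inf S < r by near: r; exact: nbhs_right_gt.
    by apply: le_trans as_ _; apply: cdf_nondecreasing; exact: ltW.
  rewrite /cdf /distribution /pushforward.
  by congr (_ <= Q _)%E; apply/seteqP; split=> x /=; rewrite in_itv.
pose F n := X @^-1` `]-oo, inf S - n.+1%:R^-1].
have mF n : measurable (F n) by exact: measurable_funPTI.
have -> : [set x | X x < inf S] = \bigcup_n F n.
  apply/seteqP; split=> [x /= /ltr_add_invr[n /ltW ltn]|x [n _]].
    by exists n; rewrite //= /F/= in_itv/= lerBrDr.
  by rewrite /F/= in_itv/= => /le_lt_trans; apply; rewrite ltrBlDr ltrDl.
have cF : Q (F n) @[n --> \oo] --> Q (\bigcup_n F n).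
  apply: nondecreasing_cvg_mu => //; first exact: bigcup_measurable.
  move=> n m nm; apply/subsetPset => x; rewrite /F/= !in_itv/= => /le_trans.
  by apply; rewrite lerB// lef_pV2 ?posrE// ler_nat.
apply: cvge_le cF; apply: nearW => n.
have [n0|n0] := leP 0 (inf S - n.+1%:R^-1); last first.
  rewrite (_ : F n = set0) ?measure0 ?lee_fin// -subset0 => x.
  rewrite /F/= in_itv/= => /le_lt_trans/(_ n0).
  by rewrite ltNge X0.
rewrite leNgt; apply/negP => /ltW aF.
have : inf S <= inf S - n.+1%:R^-1 by apply: ge_inf => //; split.
by rewrite lerBrDr gerDl leNgt invr_gt0 ltr0n.
Unshelve. all: by end_near. Qed.

(** The integral is [Q (X < k) + c Q (X = k)], which for a quantile [k] sweeps
    an interval containing [a] when [c] goes from 0 to 1. *)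
Lemma randomized_quantile (X : {RV Q >-> R}) (a : R) :
  (forall x, 0 <= X x) -> 0 <= a < 1 ->
  exists2 k, 0 <= k & exists2 c, 0 <= c <= 1 &
    \int[Q]_x threshold_test X (cst k) c x = a.
Proof.
move=> X0 a01; have [k k0 /andP[Ua aV]] := quantile_exists X0 a01.
exists k => //.
pose A := [set x | X x < k]; pose B := [set x | X x = k].
have mA : measurable A.
  rewrite (_ : A = X @^-1` `]-oo, k[); first exact: measurable_funPTI.
  by apply/seteqP; split=> x /=; rewrite in_itv.
have mB : measurable B.
  rewrite (_ : B = X @^-1` [set k])//; exact: measurable_funPTI.
have VE : Q [set x | X x <= k] = (Q A + Q B)%E.
  rewrite -measureU//; last first.
    by rewrite -subset0 => x [] /=; rewrite /A/B/= => /[swap] ->; rewrite ltxx.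
  congr (Q _); apply/seteqP; split=> x; rewrite /A /B/= le_eqVlt.
    by case/predU1P; [right|left].
  by case=> [->|/eqP ->]; rewrite ?orbT.
have fA : Q A \is a fin_num by exact: fin_num_measure.
have fB : Q B \is a fin_num by exact: fin_num_measure.
pose u := fine (Q A); pose v := fine (Q B).
have ua : u <= a by rewrite -lee_fin fineK.
have av : a <= u + v by rewrite -lee_fin EFinD !fineK// -VE.
have v0 : 0 <= v by rewrite fine_ge0.
have IE c : \int[Q]_x threshold_test X (cst k) c x = u + c * v.
  transitivity (\int[Q]_x (\1_A x + c * \1_B x)).
    apply: eq_Rintegral => x _; rewrite /threshold_test /= !indicE.
    rewrite [x \in A](_ : _ = (X x < k)); last first.
      by apply/idP/idP; rewrite inE.
    rewrite [x \in B](_ : _ = (X x == k)); last first.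
      by apply/idP/eqP; rewrite inE.
    by case: ltgtP => _ /=; rewrite ?mulr0 ?mulr1 ?addr0 ?add0r.
  have iI E : measurable E -> Q.-integrable [set: T] (EFin \o \1_E).
    by move=> mE; apply: integrable_indic => //; rewrite setIT fin_num_measure.
  rewrite RintegralD//; last 2 first.
  - exact: iI.
  - exact: (integrableZl measurableT c (iI _ mB)).
  rewrite RintegralZl//; last exact: iI.
  by rewrite /Rintegral !integral_indic// !setIT.
have [v_eq0|v_neq0] := eqVneq v 0.
  exists 0; first by rewrite lexx ler01.
  rewrite IE mul0r addr0; apply/eqP; rewrite eq_le ua.
  by move: av; rewrite v_eq0 addr0.
have v_gt0 : 0 < v by rewrite lt_def v_neq0.
exists ((a - u) / v); last by rewrite IE divfK// addrC subrK.
by rewrite divr_ge0 ?subr_ge0//= ler_pdivrMr// mul1r lerBlDl.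
Qed.

End RandomizedQuantile.

(** * Likelihood ratio tests and the Neyman-Pearson boundary *)

Section Boundary.
Context d (T : measurableType d) (R : realType).
Variables (lam : {measure set T -> \bar R}).
Variables (P Q : probability T R) (p q : T -> R).
Hypotheses (hp : is_density lam P p) (hq : is_density lam Q q).
Implicit Types (phi : T -> R) (k c t : R).

Let mp : measurable_fun [set: T] p. Proof. by case: hp. Qed.
Let mq : measurable_fun [set: T] q. Proof. by case: hq. Qed.
Let p_ge0 x : 0 <= p x. Proof. by case: hp. Qed.
Let q_ge0 x : 0 <= q x. Proof. by case: hq. Qed.

Lemma false_negativeE phi : is_test phi ->
  false_negative P phi = \int[lam]_x (phi x * p x).
Proof.
by move=> [mphi h]; apply: Rintegral_density => // x; have /andP[] := h x.
Qed.

Lemma false_positiveE phi : is_test phi ->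
  false_positive Q phi = \int[lam]_x ((1 - phi x) * q x).
Proof.
move=> /is_test_compl[mphi h].
by apply: Rintegral_density => // x; have /andP[] := h x.
Qed.

(** For [k >= 0], the least value over all tests of the error
    [k * alpha + beta]. *)
Definition bayes_risk k : R := \int[lam]_x Num.min (k * q x) (p x).

Lemma measurable_min_densities k :
  measurable_fun [set: T] (fun x => Num.min (k * q x) (p x)).
Proof. by apply: measurable_minr => //; exact: measurable_funM. Qed.

Lemma integrable_min_densities k : 0 <= k ->
  lam.-integrable [set: T] (EFin \o (fun x => Num.min (k * q x) (p x))).
Proof.
move=> k0; apply: le_integrable (density_integrable hp) => //.
  exact/measurable_EFinP/measurable_min_densities.
move=> x _ /=; rewrite lee_fin !ger0_norm// ?ge_min ?lexx ?orbT//.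
by rewrite le_min mulr_ge0/=.
Qed.

Lemma weighted_errorE k phi : is_test phi ->
  k * false_positive Q phi + false_negative P phi =
  \int[lam]_x (k * ((1 - phi x) * q x) + phi x * p x).
Proof.
move=> tphi; rewrite false_positiveE// false_negativeE//.
have [mphi h] := tphi; have [mphi' h'] := is_test_compl tphi.
have i1 := integrable_weighted hq mphi' h'.
have i2 := integrable_weighted hp mphi h.
rewrite RintegralD//; last exact: (@integrableZl _ _ _ _ _ measurableT k _ i1).
by rewrite RintegralZl.
Qed.

Lemma weighted_error_integrable k phi : is_test phi ->
  lam.-integrable [set: T]
    (EFin \o (fun x => k * ((1 - phi x) * q x) + phi x * p x)).
Proof.
move=> tphi.
have [mphi h] := tphi; have [mphi' h'] := is_test_compl tphi.
have i1 := integrable_weighted hq mphi' h'.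
have i2 := integrable_weighted hp mphi h.
exact: (integrableD measurableT (integrableZl measurableT k i1) i2).
Qed.

(** Pointwise, a convex combination of [k * q] and [p] is at least their
    minimum. *)
Lemma bayes_risk_le k phi : 0 <= k -> is_test phi ->
  bayes_risk k <= k * false_positive Q phi + false_negative P phi.
Proof.
move=> k0 tphi; rewrite weighted_errorE//; apply: le_Rintegral => //.
- exact: integrable_min_densities.
- exact: weighted_error_integrable.
move=> x _; have /andP[a b] := (tphi.2 x).
set m := Num.min _ _.
have mq' : m <= k * q x by rewrite ge_min lexx.
have mp' : m <= p x by rewrite ge_min lexx orbT.
have -> : m = (1 - phi x) * m + phi x * m by ring.
rewrite mulrCA lerD// ler_wpM2l// subr_ge0//.
Qed.

Definition likelihood_ratio_test k c : T -> R :=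
  threshold_test p (fun x => k * q x) c.

Lemma is_test_likelihood_ratio k c : 0 <= c <= 1 ->
  is_test (likelihood_ratio_test k c).
Proof. by move=> c01; apply: is_test_threshold => //; exact: measurable_funM. Qed.

Lemma bayes_risk_attained k c : 0 <= c <= 1 ->
  k * false_positive Q (likelihood_ratio_test k c) +
  false_negative P (likelihood_ratio_test k c) = bayes_risk k.
Proof.
move=> c01; rewrite weighted_errorE; last first.
  by apply: is_test_threshold => //; exact: measurable_funM.
apply: eq_Rintegral => x _; rewrite /likelihood_ratio_test /threshold_test.
have [lt|gt|eq] := ltgtP (p x) (k * q x).
- by ring.
- by ring.
- by rewrite eq; ring.
Qed.

(** The weighted inequality of means also dominates [p^t q^(1 - t)] by
    [t p + (1 - t) q], so that the Chernoff coefficient is a finite integral. *)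
Lemma bayes_risk_le_chernoff k t : 0 <= k -> 0 < t < 1 ->
  bayes_risk k <= k `^ (1 - t) * chernoff_coef lam p q t.
Proof.
move=> k0 ht; have /andP[t0 t1] := ht.
pose h x := p x `^ t * q x `^ (1 - t).
have ih : lam.-integrable [set: T] (EFin \o h).
  have ip := density_integrable hp; have iq := density_integrable hq.
  apply: le_integrable (integrableD measurableT
    (integrableZl measurableT t ip) (integrableZl measurableT (1 - t) iq)) => //.
    apply/measurable_EFinP/measurable_funM.
      exact: (measurableT_comp (measurable_powR t) mp).
    exact: (measurableT_comp (measurable_powR (1 - t)) mq).
  move=> x _ /=; rewrite lee_fin ger0_norm ?mulr_ge0 ?powR_ge0//.
  by apply: le_trans (ler_norm _); exact: powR_amgm.
rewrite -RintegralZl//; apply: le_Rintegral => //.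
- exact: integrable_min_densities.
- exact: (integrableZl measurableT (k `^ (1 - t)) ih).
move=> x _; rewrite minC mulrCA -powRM//.
by apply: minr_le_powR_mean => //; rewrite mulr_ge0.
Qed.

(** The test is compared with the threshold test on [p / q], whose level a
    quantile adjusts. The quotient is meaningless where [q = 0], but both tests
    have the same false positive rate because its integrand carries the factor
    [q]. *)
Lemma likelihood_ratio_test_level alpha : 0 < alpha <= 1 ->
  exists2 k, 0 <= k & exists2 c, 0 <= c <= 1 &
    false_positive Q (likelihood_ratio_test k c) = alpha.
Proof.
move=> /andP[a0 a1].
pose X x := p x * q x `^ (-1).
have mX : measurable_fun [set: T] X.
  apply: measurable_funM => //.
  exact: (measurableT_comp (measurable_powR (-1)) mq).
pose Y : {RV Q >-> R} := HB.pack X (isMeasurableFun.Build _ _ _ _ X mX).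
have X0 x : 0 <= X x by rewrite mulr_ge0 ?powR_ge0.
have a01 : 0 <= 1 - alpha < 1 by rewrite subr_ge0 a1 ltrBlDr ltrDl.
have [k k0 [c c01 int_c]] := randomized_quantile (X := Y) X0 a01.
exists k => //; exists c => //.
pose phi := threshold_test X (cst k) c.
have tphi : is_test phi by exact: is_test_threshold.
have -> : false_positive Q (likelihood_ratio_test k c) = false_positive Q phi.
  rewrite !false_positiveE//; last exact: is_test_likelihood_ratio.
  apply: eq_Rintegral => x _.
  have [->|qx] := eqVneq (q x) 0; first by rewrite !mulr0.
  have q0 : 0 < q x by rewrite lt_def qx q_ge0.
  rewrite /likelihood_ratio_test /phi /threshold_test /X /= powR_inv1//.
  rewrite ltr_pdivrMr//.
  have -> // : (p x / q x == k) = (p x == k * q x).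
  by rewrite -[in LHS](inj_eq (mulIf qx)) divfK.
rewrite /false_positive RintegralB//; last 2 first.
- exact: finite_measure_integrable_cst.
- exact: is_test_integrable.
rewrite [X in _ - X]int_c Rintegral_probability_cst.
by ring.
Qed.

Lemma false_positive01 phi : is_test phi -> 0 <= false_positive Q phi <= 1.
Proof.
move=> /is_test_compl tphi.
rewrite /false_positive Rintegral_ge0/=; last first.
  by move=> x _; have /andP[] := tphi.2 x.
have := @le_Rintegral _ _ _ Q setT (fun x => 1 - phi x) (cst 1) measurableT.
rewrite Rintegral_probability_cst; apply.
- exact: is_test_integrable.
- exact: finite_measure_integrable_cst.
- by move=> x _; have /andP[] := tphi.2 x.
Qed.

Lemma likelihood_ratio_test_optimal k c phi : 0 <= k -> 0 <= c <= 1 ->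
  is_test phi ->
  false_positive Q phi = false_positive Q (likelihood_ratio_test k c) ->
  false_negative P (likelihood_ratio_test k c) <= false_negative P phi.
Proof.
move=> k0 c01 tphi fpE; have := bayes_risk_le k0 tphi.
by rewrite -(bayes_risk_attained k c01) fpE lerD2l.
Qed.

(** The likelihood ratio test with infinite threshold. *)
Definition support_test (x : T) : R := if 0 < q x then 1 else 0.

Lemma is_test_support : is_test support_test.
Proof.
split; last by move=> x; rewrite /support_test; case: ifP; rewrite lexx ler01.
by apply: measurable_fun_ifT => //; exact: measurable_fun_ltr.
Qed.

Lemma false_positive_support_test : false_positive Q support_test = 0.
Proof.
rewrite (false_positiveE is_test_support) /Rintegral.
rewrite integral0_eq// => x _; congr EFin; rewrite /support_test.
have [_|q0] := ltP 0 (q x); first by rewrite subrr mul0r.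
by rewrite (le_anti (_ : q x <= 0 <= q x)) ?mulr0// q0 q_ge0.
Qed.

(** A test without false positives equals 1 almost everywhere on [q > 0]. *)
Lemma support_test_optimal phi : is_test phi -> false_positive Q phi = 0 ->
  false_negative P support_test <= false_negative P phi.
Proof.
move=> tphi fp0.
have tphi' := is_test_compl tphi; have ts := is_test_support.
rewrite !false_negativeE//.
apply: (le_Rintegral_on_zeros (f := fun x => (1 - phi x) * q x)) => //.
- exact: integrable_weighted hq tphi'.1 tphi'.2.
- exact: integrable_weighted hp ts.1 ts.2.
- exact: integrable_weighted hp tphi.1 tphi.2.
- by move=> x; rewrite mulr_ge0//; have /andP[] := tphi'.2 x.
- by move=> x; rewrite mulr_ge0//; have /andP[] := ts.2 x.
- by move=> x; rewrite mulr_ge0//; have /andP[] := tphi.2 x.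
- move=> x /eqP; rewrite mulf_eq0 subr_eq0 => phiq.
  rewrite ler_wpM2r// /support_test; case: ifPn => q0.
    by move: phiq; rewrite (gt_eqF q0) orbF => /eqP ->.
  by have /andP[] := tphi.2 x.
- by rewrite -false_positiveE.
Qed.

(** If [rho = 0] then [min (q, p)] has zero integral, hence [p] vanishes almost
    everywhere on [q > 0]. *)
Lemma false_negative_support_test t : 0 < t < 1 ->
  chernoff_coef lam p q t = 0 -> false_negative P support_test <= 0.
Proof.
move=> ht rho0; have ts := is_test_support.
have b0 : bayes_risk 1 = 0.
  apply/eqP; rewrite eq_le Rintegral_ge0; last first.
    by move=> x _; rewrite le_min mul1r q_ge0/=.
  have := bayes_risk_le_chernoff (@ler01 R) ht.
  by rewrite rho0 mulr0 => ->.
have z0 : \int[lam]_x (0 : R) = 0 by rewrite /Rintegral integral0.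
rewrite (false_negativeE ts) -[leRHS]z0.
apply: (le_Rintegral_on_zeros (f := fun x => Num.min (1 * q x) (p x))) => //.
- exact: (integrable_min_densities (@ler01 R)).
- exact: integrable_weighted hp ts.1 ts.2.
- exact: integrable0.
- by move=> x; rewrite le_min mul1r q_ge0/=.
- by move=> x; rewrite mulr_ge0//; have /andP[] := ts.2 x.
move=> x; rewrite mul1r /support_test.
have [q0|q0] := ltP 0 (q x); last by rewrite mul0r.
rewrite mul1r; case: (leP (q x) (p x)) => [_ qx0|_ ->//].
by rewrite qx0 ltxx in q0.
Qed.

Lemma np_boundary_exists alpha : 0 <= alpha <= 1 ->
  exists beta, np_boundary P Q (alpha, beta).
Proof.
move=> /andP[]; rewrite le_eqVlt => /predU1P[<- _|a0 a1].
  exists (false_negative P support_test); split.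
    exists support_test; first exact: is_test_support.
    by rewrite false_positive_support_test.
  by move=> b [phi tphi [fp0 <-]]; exact: support_test_optimal.
have [|k k0 [c c01 fpE]] := likelihood_ratio_test_level (alpha := alpha).
  by rewrite a0.
exists (false_negative P (likelihood_ratio_test k c)); split.
  exists (likelihood_ratio_test k c); first exact: is_test_likelihood_ratio.
  by rewrite fpE.
move=> b [phi tphi [fp <-]] /=.
by apply: likelihood_ratio_test_optimal => //; rewrite fpE.
Qed.

Lemma np_boundary_le_curve t alpha beta : 0 < t < 1 ->
  np_boundary P Q (alpha, beta) ->
  (beta%:E <= chernoff_curve t (chernoff_coef lam p q t) alpha)%E.
Proof.
move=> ht [[phi tphi [fpE _]] /= bmin].
have rho0 : 0 <= chernoff_coef lam p q t.
  by apply: Rintegral_ge0 => x _; rewrite mulr_ge0 ?powR_ge0.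
have := false_positive01 tphi; rewrite fpE => /andP[].
rewrite le_eqVlt => /predU1P[aE _|a0 a1].
  move: rho0; rewrite le_eqVlt => /predU1P[rho0|rho0].
    rewrite (le_trans _ (chernoff_curve_ge0 _ _ _))// lee_fin.
    apply: le_trans (false_negative_support_test ht (esym rho0)).
    apply: bmin; exists support_test; first exact: is_test_support.
    by rewrite false_positive_support_test aE.
  have /andP[t0 t1] := ht.
  rewrite /chernoff_curve /epowR -aE eqxx/= ifT; last first.
    by rewrite pmulr_llt0 ?invr_gt0// subr_lt0.
  rewrite gt0_muley ?leey// lte_fin powR_gt0// !mulr_gt0// powR_gt0//.
  by rewrite subr_gt0.
have [|k k0 [c c01 levelE]] := likelihood_ratio_test_level (alpha := alpha).
  by rewrite a0.
apply: le_trans (chernoff_tangent_le ht rho0 a0 k0); rewrite lee_fin.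
have bE : beta <= false_negative P (likelihood_ratio_test k c).
  apply: bmin; exists (likelihood_ratio_test k c) => //.
    exact: is_test_likelihood_ratio.
  by rewrite levelE.
apply: le_trans bE _; rewrite lerBrDl -levelE.
rewrite (bayes_risk_attained k c01).
exact: (bayes_risk_le_chernoff k0 ht).
Qed.

End Boundary.

(* The envelope of the lines is the curve over alpha > 0.  This needs rho > 0:
   when P and Q are mutually singular all the lines pass through the origin and
   the two envelope equations hold there only, whereas the curve is the half
   axis beta = 0. *)
Theorem proposition3 (d : measure_display) (T : measurableType d)
    (R : realType) (lam : {measure set T -> \bar R}) (P Q : probability T R)
    (p q : T -> R) (q0 : R)
    (hp : is_density lam P p) (hq : is_density lam Q q)
    (hq0 : 0 < q0 < 1) :
  let rho := chernoff_coef lam p q q0 in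
  [/\ 0 < rho ->
        envelope `]0, 2[ (chernoff_line q0 rho) =
        [set ab | 0 < ab.1 /\ ab.2%:E = chernoff_curve q0 rho ab.1],
      forall alpha, 0 <= alpha <= 1 ->
        exists beta, np_boundary P Q (alpha, beta) &
      forall alpha beta, np_boundary P Q (alpha, beta) ->
        (beta%:E <= chernoff_curve q0 rho alpha)%E].
Proof.
move=> rho; split.
- exact: envelope_chernoff_line.
- exact: np_boundary_exists hp hq.
- by move=> alpha beta; exact: np_boundary_le_curve hp hq _ _ _ hq0.
Qed.
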